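(* If $\rho$ is a positive integer divisible by $9$, then $M(\rho)=4$.
   Context: For a positive integer $\rho$, let $S_\rho=\{n\in\mathbb{Z} : n\ge 0,\ n\neq\rho\}$. For a positive integer $n$, let $k_\rho(n)$ be the least positive integer $m$ such that $n=x_1^2+\cdots+x_m^2$ for some $x_1,\dots,x_m\in S_\rho$, and $k_\rho(n)=\infty$ if no such $m$ exists. Let $I(\rho)=\{n\ge1 : k_\rho(n)=\infty\}$ and $M(\rho)=\max\{k_\rho(n) : n\ge 1,\ n\notin I(\rho)\}$. *)

(* Defs.v *)
From HB Require Import structures.
From mathcomp Require Import all_boot.
From mathcomp Require Import boolp classical_sets.

Set Implicit Arguments.
Unset Strict Implicit.
Unset Printing Implicit Defensive.

Local Open Scope classical_set_scope.

(* [None] stands for the value at which no minimum (resp. maximum) exists; for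
   a minimum over [nat] this happens exactly when the set is empty. *)
Definition least (A : set nat) : option nat :=
  xget None [set Some m | m in [set m | A m /\ forall a, A a -> m <= a]].

Definition greatest (A : set nat) : option nat :=
  xget None [set Some m | m in [set m | A m /\ forall a, A a -> a <= m]].

Lemma least_Some (A : set nat) (m : nat) :
  least A = Some m <-> A m /\ forall a, A a -> m <= a.
Proof.
rewrite /least; split => [|[Am lm]].
  by case: xgetP => [_ -> [p Pp <-] [<-]|].
case: xgetP => [_ -> [p [Ap lp] <-]|/(_ (Some m))[]].
  by congr Some; apply/eqP; rewrite eqn_leq lp ?lm.
by exists m.
Qed.

Lemma least_None (A : set nat) : least A = None <-> A = set0.
Proof.
split=> [AN|->]; last first.
  by case E : (least set0) => [m|//]; case/least_Some: E.
apply: contrapT => /eqP/set0P[a Aa].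
have exA : exists a, `[< A a >] by exists a; apply/asboolP.
case: (ex_minnP exA) => m /asboolP Am lm.
suff : least A = Some m by rewrite AN.
by apply/least_Some; split=> // b Ab; apply/lm/asboolP.
Qed.

Lemma greatest_Some (A : set nat) (m : nat) :
  greatest A = Some m <-> A m /\ forall a, A a -> a <= m.
Proof.
rewrite /greatest; split => [|[Am lm]].
  by case: xgetP => [_ -> [p Pp <-] [<-]|].
case: xgetP => [_ -> [p [Ap lp] <-]|/(_ (Some m))[]].
  by congr Some; apply/eqP; rewrite eqn_leq lm ?lp.
by exists m.
Qed.

Definition S_ (rho : nat) : set nat := [set n | n <> rho].

Definition sum_of_squares_in (A : set nat) (m n : nat) : Prop :=
  exists x : 'I_m -> nat,
    (forall i, A (x i)) /\ n = \sum_(i < m) x i ^ 2.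

(* The value [None] means infinity. *)
Definition k_ (rho n : nat) : option nat :=
  least [set m | 0 < m /\ sum_of_squares_in (S_ rho) m n].

Definition I_ (rho : nat) : set nat := [set n | 1 <= n /\ k_ rho n = None].

Definition M_ (rho : nat) : option nat :=
  greatest [set m | exists n, [/\ 1 <= n, ~ I_ rho n & k_ rho n = Some m]].

(* Main.v *)
(** By Lagrange every n is a sum of four squares; isometries with denominator 3
    move a representation away from rho = 9q. Only integers divisible by 3 can
    equal +-rho, so representations are sorted by their residues mod 3, signs
    being chosen so that each residue is 0 or 1.

    If 3 does not divide n, the residues are (1,1,1,1), (1,1,0,0) or (1,0,0,0).
    The first is harmless. In the second, reflect the triple made of the two
    units and of a coordinate +-rho in the vector (1,1,1), with a suitable sign
    of rho. In the third, reflect the three multiples of 3, after dividing them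
    by the largest possible power of 3.

    If n = 3m, right multiplication of a quaternion of norm m by one of norm 3
    turns a representation of m that avoids rho and is not divisible by 3 into
    one of n with the same two properties, for a suitable order and choice of
    signs of its coordinates. The bound 4 is attained at 7. *)

Require Import Defs.
From HB Require Import structures.
From mathcomp Require Import all_boot all_order all_algebra.
From mathcomp Require Import boolp classical_sets.
From mathcomp Require Import zify ring.

Set Implicit Arguments.
Unset Strict Implicit.
Unset Printing Implicit Defensive.

Import Order.TTheory GRing.Theory Num.Theory.

Local Open Scope ring_scope.

(** * Lagrange's four-square theorem over the integers *)

Definition sumsq4 (a b c d : int) : int := a ^+ 2 + b ^+ 2 + c ^+ 2 + d ^+ 2.

Definition is_sumsq4 (n : int) : Prop := exists a b c d, n = sumsq4 a b c d.

(** Euler's identity: the witnesses are the coordinates of the second quaternion times the conjugate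
    of the first. *)
Lemma is_sumsq4M (m n : int) :
  is_sumsq4 m -> is_sumsq4 n -> is_sumsq4 (m * n).
Proof.
move=> [a [b [c [d ->]]]] [x [y [z [t ->]]]].
exists (a * x + b * y + c * z + d * t), (a * y - b * x + c * t - d * z).
exists (a * z - b * t - c * x + d * y), (a * t + b * z - c * y - d * x).
by rewrite /sumsq4; ring.
Qed.

(** Pigeonhole in ['F_p]: for 0 <= i, j <= (p - 1)/2 the values i^2, and likewise the values -1 -
    j^2, are (p + 1)/2 in number, so the two sets meet. *)
Lemma prime_dvd_sumsq2_add1 (p : nat) : prime p -> odd p ->
  exists a b : nat, [/\ (a <= p./2)%N, (b <= p./2)%N
    & (p %| a ^ 2 + b ^ 2 + 1)%N].
Proof.
move=> p_pr p_odd; set k := p./2.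
have pE : p = (2 * k).+1 by rewrite -[LHS]odd_double_half p_odd -muln2 mulnC.
pose f (i : 'I_k.+1) : 'F_p := i%:R ^+ 2.
have f_inj : injective f.
  move=> i j /eqP; rewrite /f eqf_sqr => /orP[/eqP/(congr1 (@nat_of_ord _))|].
    rewrite !val_Fp_nat // !modn_small; first exact: ord_inj.
      by have := ltn_ord j; lia.
    by have := ltn_ord i; lia.
  (* If i = -j, then p divides i + j <= 2k < p, so i = j = 0. *)
  rewrite -subr_eq0 opprK -natrD -(dvdn_pcharf (pchar_Fp p_pr)) => dv.
  apply/ord_inj; have := ltn_ord j; have := ltn_ord i.
  by case: (posnP (i + j)%N) => [|/dvdn_leq/(_ dv)]; lia.
pose A := [set f i | i : 'I_k.+1]; pose B := [set - 1 - f i | i : 'I_k.+1].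
have cA : #|A| = k.+1 by rewrite card_imset // card_ord.
have cB : #|B| = k.+1.
  by rewrite card_imset ?card_ord // => i j /addrI/oppr_inj/f_inj.
have : A :&: B != finset.set0.
  rewrite -card_gt0; have := max_card (mem (A :|: B)).
  by rewrite card_Fp // cardsU cA cB; lia.
case/finset.set0Pn => _ /setIP[/imsetP[i _ ->] /imsetP[j _ fij]].
exists i, j; split; [have := ltn_ord i; lia | have := ltn_ord j; lia |].
rewrite (dvdn_pcharf (pchar_Fp p_pr)) !natrD !natrX -/(f i) fij /f.
by apply/eqP; ring.
Qed.

Lemma centered_divz (m x : int) : 0 < m ->
  exists q r : int, x = m * q + r /\ - m <= 2 * r <= m.
Proof.
move=> m_gt0; have xE := divz_eq x m.
have r_ge0 := modz_ge0 x (lt0r_neq0 m_gt0); have r_lt := ltz_pmod x m_gt0.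
have [h|h] := leP (2 * (x %% m)%Z) m.
  by exists (x %/ m)%Z, (x %% m)%Z; split; lia.
by exists ((x %/ m)%Z + 1), ((x %% m)%Z - m); split; lia.
Qed.

(** Remainders of least absolute value modulo m have a sum of squares m m' with m' <= m. Euler's
    identity then writes m^2 m' p as a sum of four squares of multiples of m. Both extremes m' = 0
    and m' = m would make m divide p. *)
Lemma sumsq4_descent (p m : int) : 1 < m -> ~ (exists k, p = m * k) ->
  is_sumsq4 (m * p) ->
  exists m', 0 < m' < m /\ is_sumsq4 (m' * p).
Proof.
move=> m_gt1 ndvd [a [b [c [d mpE]]]].
have m_gt0 : 0 < m by lia.
have mI (u v : int) : m * u = m * v -> u = v by apply: mulfI; lia.
have [qa [ra [aE ra_le]]] := centered_divz a m_gt0.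
have [qb [rb [bE rb_le]]] := centered_divz b m_gt0.
have [qc [rc [cE rc_le]]] := centered_divz c m_gt0.
have [qd [rd [dE rd_le]]] := centered_divz d m_gt0.
(* Obtained by expanding m p as the sum of the squares of the m q + r and solving for the sum of the
   r^2. *)
pose m' := p - m * sumsq4 qa qb qc qd
           - 2 * (qa * ra + qb * rb + qc * rc + qd * rd).
have rE : sumsq4 ra rb rc rd = m * m'.
  apply/eqP; rewrite -subr_eq0 /m' !mulrBr mpE aE bE cE dE /sumsq4.
  by apply/eqP; ring.
have sq_le (r : int) : - m <= 2 * r <= m -> 4 * r ^+ 2 <= m ^+ 2.
  by move=> h; nia.
have := (sq_le _ ra_le, sq_le _ rb_le, sq_le _ rc_le, sq_le _ rd_le).
move=> [[[la lb] lc] ld].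
have m'_ge0 : 0 <= m' by rewrite /sumsq4 in rE; nia.
have m'_le : m' <= m by rewrite /sumsq4 in rE; nia.
have m'_neq0 : m' <> 0.
  move=> m'0; apply: ndvd; exists (sumsq4 qa qb qc qd).
  have [? [? [? ?]]] : ra = 0 /\ rb = 0 /\ rc = 0 /\ rd = 0.
    by rewrite /sumsq4 in rE; nia.
  by apply: mI; rewrite mpE aE bE cE dE /sumsq4; subst; ring.
(* Here every remainder is +-m/2, so each cross term 2 q r is a multiple of m. *)
have m'_neqm : m' <> m.
  move=> m'm.
  have sq_eq (r : int) : 4 * r ^+ 2 = m ^+ 2 -> 2 * r = m \/ 2 * r = - m.
    rewrite (_ : 4 * r ^+ 2 = (2 * r) ^+ 2); last by ring.
    by move/eqP; rewrite eqf_sqr => /orP[]/eqP; [left|right].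
  have ea : 4 * ra ^+ 2 = m ^+ 2 by rewrite /sumsq4 m'm in rE; lia.
  have eb : 4 * rb ^+ 2 = m ^+ 2 by rewrite /sumsq4 m'm in rE; lia.
  have ec : 4 * rc ^+ 2 = m ^+ 2 by rewrite /sumsq4 m'm in rE; lia.
  have ed : 4 * rd ^+ 2 = m ^+ 2 by rewrite /sumsq4 m'm in rE; lia.
  have mult (q r : int) : 4 * r ^+ 2 = m ^+ 2 ->
      exists u, 2 * (q * r) = m * u.
    by move=> /sq_eq[rm|rm]; [exists q|exists (- q)]; rewrite mulrCA rm; ring.
  have [[ua eua] [ub eub]] := (mult qa _ ea, mult qb _ eb).
  have [[uc euc] [ud eud]] := (mult qc _ ec, mult qd _ ed).
  apply: ndvd; exists (sumsq4 qa qb qc qd + ua + ub + uc + ud + 1).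
  have : p = m' + m * sumsq4 qa qb qc qd
             + 2 * (qa * ra + qb * rb + qc * rc + qd * rd).
    by rewrite /m'; ring.
  by rewrite !mulrDr eua eub euc eud m'm mulr1 => ->; ring.
exists m'; split; first by lia.
(* Euler's coordinates vanish modulo m because each of a, b, c, d is congruent to its remainder. *)
have [x [y [z [t E]]]] : exists x y z t,
   [/\ m * x = a * ra + b * rb + c * rc + d * rd,
       m * y = a * rb - b * ra + c * rd - d * rc,
       m * z = a * rc - b * rd - c * ra + d * rb
     & m * t = a * rd + b * rc - c * rb - d * ra].
  exists (qa * ra + qb * rb + qc * rc + qd * rd + m').
  exists (qa * rb - qb * ra + qc * rd - qd * rc).
  exists (qa * rc - qb * rd - qc * ra + qd * rb).
  exists (qa * rd + qb * rc - qc * rb - qd * ra).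
  rewrite mulrDr -rE aE bE cE dE /sumsq4; split; ring.
exists x, y, z, t; do 2!apply: (mI); case: E => Ex Ey Ez Et.
have -> : m * (m * (m' * p)) = (m * m') * (m * p) by ring.
have -> : m * (m * sumsq4 x y z t)
  = (m * x) ^+ 2 + (m * y) ^+ 2 + (m * z) ^+ 2 + (m * t) ^+ 2.
  by rewrite /sumsq4; ring.
by rewrite Ex Ey Ez Et -rE mpE /sumsq4; ring.
Qed.

Lemma prime_is_sumsq4 (p : nat) : prime p -> is_sumsq4 p%:Z.
Proof.
move=> p_pr; have [->|p_odd] := even_prime p_pr.
  by exists 1, 1, 0, 0.
have p_gt1 := prime_gt1 p_pr.
have descent (m : nat) : (0 < m < p)%N -> is_sumsq4 (m%:Z * p%:Z) ->
    is_sumsq4 p%:Z.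
  elim/ltn_ind: m => m IH m_bd mp.
  have [m_gt1|m_le1] := ltnP 1 m; last first.
    have m1 : m = 1%N by lia.
    by move: mp; rewrite m1 mul1r.
  have ndvd : ~ exists k, p%:Z = m%:Z * k.
    case=> k pE; have : (m %| p)%N.
      by apply/dvdnP; exists `|k|%N; nia.
    have m_neq1 : m != 1%N by lia.
    by move/(prime_nt_dvdP p_pr m_neq1); lia.
  have [|m' [m'_bd m'p]] := sumsq4_descent _ ndvd mp; first by lia.
  have m'E : m' = `|m'|%N%:Z by lia.
  by apply: (IH `|m'|%N); rewrite -?m'E //; lia.
have [a [b [a_le b_le /dvdnP[m mE]]]] := prime_dvd_sumsq2_add1 p_pr p_odd.
(* m < p because a, b <= (p - 1)/2 give a^2 + b^2 + 1 < p^2. *)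
apply: (descent m); first by nia.
exists a%:Z, b%:Z, 1, 0; rewrite /sumsq4; lia.
Qed.

Theorem lagrange_four_squares (n : nat) : is_sumsq4 n%:Z.
Proof.
elim/ltn_ind: n => n IH.
have [n_gt1|n_le1] := ltnP 1 n; last first.
  by exists n%:Z, 0, 0, 0; rewrite /sumsq4; nia.
have /dvdnP[m nE] := pdiv_dvd n.
have p_pr := pdiv_prime n_gt1; have p_gt1 := prime_gt1 p_pr.
rewrite {1}nE PoszM; apply: is_sumsq4M; last exact: prime_is_sumsq4.
by apply: IH; nia.
Qed.

(** * Residues modulo 3 and reflections away from +-rho *)

Definition avoids (r x : int) : Prop := x <> r /\ x <> - r.

Lemma avoids_mul3 (r x : int) : avoids r x -> avoids (3 * r) (3 * x).
Proof. by case=> ? ?; split; lia. Qed.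

Lemma mod3_cases (u : int) :
  (exists v, u = 3 * v) \/ (exists v, u = 3 * v + 1) \/
  (exists v, u = 3 * v - 1).
Proof.
have := divz_eq u 3; have := modz_ge0 u (isT : 3%:Z != 0).
have := ltz_pmod u (isT : 0 < 3%:Z).
have [|[|]] : (u %% 3)%Z <= 0 \/ (u %% 3)%Z = 1 \/ (u %% 3)%Z >= 2 by lia.
- by left; exists (u %/ 3)%Z; lia.
- by right; left; exists (u %/ 3)%Z; lia.
- by right; right; exists ((u %/ 3)%Z + 1); lia.
Qed.

(** Negating the coordinates congruent to -1 and permuting leaves only the number of multiples of 3.
    [P] is a property carried along under negation. The last case keeps the equations on the
    coordinates themselves, so that [primitive_avoiding_mul3] can refute it through [a]. *)
Lemma sumsq4_mod3_wlog (P : int -> Prop) (a b c d : int) (Q : Prop) :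
  (forall x, P x -> P (- x)) -> P a -> P b -> P c -> P d ->
  (forall x y z t, P (3 * x + 1) -> P (3 * y + 1) -> P (3 * z + 1) ->
    P (3 * t + 1) -> sumsq4 a b c d
      = sumsq4 (3 * x + 1) (3 * y + 1) (3 * z + 1) (3 * t + 1) -> Q) ->
  (forall x y z t, P (3 * x + 1) -> P (3 * y + 1) -> P (3 * z + 1) ->
    P (3 * t) -> sumsq4 a b c d
      = sumsq4 (3 * x + 1) (3 * y + 1) (3 * z + 1) (3 * t) -> Q) ->
  (forall x y z t, P (3 * x + 1) -> P (3 * y + 1) -> P (3 * z) ->
    P (3 * t) -> sumsq4 a b c d
      = sumsq4 (3 * x + 1) (3 * y + 1) (3 * z) (3 * t) -> Q) ->
  (forall x y z t, P (3 * x + 1) -> P (3 * y) -> P (3 * z) -> P (3 * t) ->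
    sumsq4 a b c d = sumsq4 (3 * x + 1) (3 * y) (3 * z) (3 * t) -> Q) ->
  (forall x y z t, a = 3 * x -> b = 3 * y -> c = 3 * z -> d = 3 * t -> Q) -> Q.
Proof.
move=> PN Pa Pb Pc Pd Q4 Q3 Q2 Q1 Q0.
have red (u : int) : P u ->
    exists v, [/\ P (3 * v), u ^+ 2 = (3 * v) ^+ 2 & u = 3 * v]
      \/ (P (3 * v + 1) /\ u ^+ 2 = (3 * v + 1) ^+ 2).
  move=> Pu; have [[v uE]|[[v uE]|[v uE]]] := mod3_cases u.
  - by exists v; left; rewrite -uE.
  - by exists v; right; rewrite -uE.
  - exists (- v); right; rewrite (_ : 3 * - v + 1 = - u); last by lia.
    by rewrite sqrrN; split=> //; apply: PN.
have [x hx] := red _ Pa; have [y hy] := red _ Pb.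
have [z hz] := red _ Pc; have [t ht] := red _ Pd.
rewrite /sumsq4 in Q1 Q2 Q3 Q4.
case: hx => -[Px ex]; case: hy => -[Py ey]; case: hz => -[Pz ez];
  case: ht => -[Pt et]; rewrite ex ey ez et in Q1 Q2 Q3 Q4.
- by move=> ? ? ? ?; apply: (Q0 x y z t).
- by move=> *; apply: (Q1 t x y z) => //; ring.
- by move=> *; apply: (Q1 z x y t) => //; ring.
- by move=> *; apply: (Q2 z t x y) => //; ring.
- by move=> *; apply: (Q1 y x z t) => //; ring.
- by move=> *; apply: (Q2 y t x z) => //; ring.
- by move=> *; apply: (Q2 y z x t) => //; ring.
- by move=> *; apply: (Q3 y z t x) => //; ring.
- by move=> *; apply: (Q1 x y z t) => //; ring.
- by move=> *; apply: (Q2 x t y z) => //; ring.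
- by move=> *; apply: (Q2 x z y t) => //; ring.
- by move=> *; apply: (Q3 x z t y) => //; ring.
- by move=> *; apply: (Q2 x y z t) => //; ring.
- by move=> *; apply: (Q3 x y t z) => //; ring.
- by move=> *; apply: (Q3 x y z t) => //; ring.
- exact: (Q4 x y z t).
Qed.

(* With s = x +- y +- r, the squares of 2s - 3x, 2s -+ 3y, 2s -+ 3r have the
   same sum as those of 3x, 3y, 3r, and none of the new numbers is divisible by
   3 if s is not. If all choices of signs make s a multiple of 3, then 3 divides
   x, y and r. *)
Lemma avoid_three_multiples (r : nat) (x y : int) : (0 < r)%N ->
  exists a b c : int, [/\ (3 * x) ^+ 2 + (3 * y) ^+ 2 + (3 * r%:Z) ^+ 2
    = a ^+ 2 + b ^+ 2 + c ^+ 2, avoids (3 * r%:Z) a, avoids (3 * r%:Z) b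
    & avoids (3 * r%:Z) c].
Proof.
elim/ltn_ind: r x y => r IH x y r_gt0.
have refl (y' z' : int) : y' ^+ 2 = y ^+ 2 -> z' ^+ 2 = r%:Z ^+ 2 ->
    ~ (exists v, x + y' + z' = 3 * v) ->
    exists a b c : int, [/\ (3 * x) ^+ 2 + (3 * y) ^+ 2 + (3 * r%:Z) ^+ 2
    = a ^+ 2 + b ^+ 2 + c ^+ 2, avoids (3 * r%:Z) a, avoids (3 * r%:Z) b
    & avoids (3 * r%:Z) c].
  move=> ey ez ndvd; pose s := x + y' + z'.
  exists (2 * s - 3 * x), (2 * s - 3 * y'), (2 * s - 3 * z').
  have ndvd' (u : int) : 2 * s = 3 * u -> False.
    by move=> sE; apply: ndvd; exists (u - (s - u)); rewrite -/s; lia.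
  split.
  - by rewrite !exprMn -ey -ez /s; ring.
  - split=> E; [apply: (ndvd' (x + r%:Z)) | apply: (ndvd' (x - r%:Z))]; lia.
  - split=> E; [apply: (ndvd' (y' + r%:Z)) | apply: (ndvd' (y' - r%:Z))]; lia.
  - split=> E; [apply: (ndvd' (z' + r%:Z)) | apply: (ndvd' (z' - r%:Z))]; lia.
have [d1|d1] := pselect (exists v, x + y + r%:Z = 3 * v); last exact: refl d1.
have [d2|d2] := pselect (exists v, x + y + - r%:Z = 3 * v); last first.
  by apply: refl d2 => //; rewrite sqrrN.
have [d3|d3] := pselect (exists v, x + - y + r%:Z = 3 * v); last first.
  by apply: refl d3 => //; rewrite sqrrN.
case: d1 d2 d3 => [v1 e1] [v2 e2] [v3 e3].
(* Subtracting the first two equations gives 2r = 3(v1 - v2), and r = 3r - 2r. The same trick yields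
   [xE] and [yE], and the induction continues with r/3. *)
have [w rw] : exists w, r%:Z = 3 * w by exists (r%:Z - (v1 - v2)); lia.
move: rw (r_gt0) => rw r_gt0'; have w_gt0 : 0 < w by lia.
have wE : `|w|%N%:Z = w by lia.
have xE : x = 3 * (x - (v2 + v3)) by lia.
have yE : y = 3 * (y - (v1 - v3)) by lia.
have [||a [b [c [E Ha Hb Hc]]]] := IH `|w|%N _ (x - (v2 + v3))
  (y - (v1 - v3)); [lia|lia|].
have rE' : r%:Z = 3 * `|w|%N%:Z by lia.
exists (3 * a), (3 * b), (3 * c); split.
- rewrite xE yE rE'; set l := LHS; set t := RHS.
  have -> : t = 9 * (a ^+ 2 + b ^+ 2 + c ^+ 2) by rewrite /t; ring.
  by rewrite -E /l; ring.
- by rewrite rE'; apply: avoids_mul3.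
- by rewrite rE'; apply: avoids_mul3.
- by rewrite rE'; apply: avoids_mul3.
Qed.

(* The triple (3x + 1, - (3y + 1), 9w), where w = +-q, has sum 3e with
   e = x - y + 3w; subtracting its entries from 2e gives, up to order and signs,
   the new triple. Which entry is divisible by 3 does not depend on the sign of
   w because 9 divides rho, and one of the two signs makes that entry avoid
   +-9q. *)
Lemma avoid_two_units_one_multiple (q x y : int) : q <> 0 ->
  exists x' y' z' : int, [/\ (3 * x + 1) ^+ 2 + (3 * y + 1) ^+ 2 + (9 * q) ^+ 2
    = (3 * x' + 1) ^+ 2 + (3 * y' + 1) ^+ 2 + (3 * z') ^+ 2,
    avoids (9 * q) (3 * x' + 1), avoids (9 * q) (3 * y' + 1)
    & avoids (9 * q) (3 * z')].
Proof.
move=> q_neq0.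
have na (u : int) : avoids (9 * q) (3 * u + 1) by split; lia.
have [[s sE]|[[s sE]|[s sE]]] := mod3_cases (x - y).
- have [w [wE w_avoids]] : exists w, w ^+ 2 = q ^+ 2 /\
      avoids (9 * q) (3 * (2 * s - w)).
    (* Failure for both signs would put 2s in {4q, -2q} and in {2q, -4q}, which are disjoint. The
       two other cases are similar. *)
    have [h|h] := pselect (avoids (9 * q) (3 * (2 * s - q))); first by exists q.
    exists (- q); rewrite sqrrN; split=> //; move: h; rewrite /avoids; lia.
  exists (x - 2 * s - 2 * w), (y + 2 * s + 2 * w), (2 * s - w).
  split=> //; rewrite exprMn -wE (_ : x = y + 3 * s); first by ring.
  lia.
- have [w [wE w_avoids]] : exists w, w ^+ 2 = q ^+ 2 /\
      avoids (9 * q) (3 * (2 * s + 1 + 2 * w + y)).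
    have [h|h] := pselect (avoids (9 * q) (3 * (2 * s + 1 + 2 * q + y))).
      by exists q.
    exists (- q); rewrite sqrrN; split=> //; move: h; rewrite /avoids; lia.
  exists (2 * s + 2 * w - x), (w - 2 * s - 1), (2 * s + 1 + 2 * w + y).
  split=> //; rewrite exprMn -wE (_ : x = y + 3 * s + 1); first by ring.
  lia.
- have [w [wE w_avoids]] : exists w, w ^+ 2 = q ^+ 2 /\
      avoids (9 * q) (3 * (2 * s - 1 + 2 * w - x)).
    have [h|h] := pselect (avoids (9 * q) (3 * (2 * s - 1 + 2 * q - x))).
      by exists q.
    exists (- q); rewrite sqrrN; split=> //; move: h; rewrite /avoids; lia.
  exists (- 2 * s - 2 * w - y), (2 * s - 1 - w), (2 * s - 1 + 2 * w - x).
  split=> //; rewrite exprMn -wE (_ : x = y + 3 * s - 1); first by ring.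
  lia.
Qed.

(** * Primitive representations of integers prime to 3 *)

Lemma avoidsN (r x : int) : avoids r x -> avoids r (- x).
Proof. by case=> ? ?; split; lia. Qed.

Lemma not_avoids_sqr (r x : int) : ~ avoids r x -> x ^+ 2 = r ^+ 2.
Proof.
move=> h; have [->//|->] : x = r \/ x = - r by move: h; rewrite /avoids; lia.
by rewrite sqrrN.
Qed.

(* As signs are free, [a = 3 * u + 1] only says that 3 does not divide [a]. *)
Definition primitive_avoiding (r n : int) : Prop :=
  exists a b c d, [/\ n = sumsq4 a b c d,
    [/\ avoids r a, avoids r b, avoids r c & avoids r d]
    & exists u, a = 3 * u + 1].

Lemma primitive_avoiding_coprime3 (q n : nat) : (0 < q)%N -> ~~ (3 %| n)%N ->
  primitive_avoiding (9 * q%:Z) n%:Z.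
Proof.
move=> q_gt0 n3; have q_neq0 : q%:Z <> 0 by lia.
have na (u : int) : avoids (9 * q%:Z) (3 * u + 1) by split; lia.
have [a [b [c [d nE]]]] := lagrange_four_squares n.
apply: (@sumsq4_mod3_wlog (fun=> True) a b c d) => //; rewrite -?nE.
- move=> x y z t _ _ _ _ E.
  exists (3 * x + 1), (3 * y + 1), (3 * z + 1), (3 * t + 1).
  by split=> //; exists x.
- move=> x y z t _ _ _ _ E; suff : (3 %| n)%N by rewrite (negPf n3).
  have : n%:Z = 3 * (3 * (x^+2 + y^+2 + z^+2 + t^+2) + 2 * (x + y + z) + 1).
    by rewrite E /sumsq4; ring.
  lia.
- move=> x y z t _ _ _ _ E.
  (* The reflection of the two units with one multiple of 3 fixes the other multiple, so the two
     multiples can be repaired one after the other. *)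
  have key (x1 y1 z1 t1 : int) : avoids (9 * q%:Z) (3 * z1) ->
      n%:Z = sumsq4 (3 * x1 + 1) (3 * y1 + 1) (3 * z1) (3 * t1) ->
      primitive_avoiding (9 * q%:Z) n%:Z.
    move=> hz E1.
    have [ht|/not_avoids_sqr ht] := pselect (avoids (9 * q%:Z) (3 * t1)).
      exists (3 * x1 + 1), (3 * y1 + 1), (3 * z1), (3 * t1).
      by split=> //; exists x1.
    have [x' [y' [z' [E' hx' hy' hz']]]] :=
      avoid_two_units_one_multiple x1 y1 q_neq0.
    exists (3 * x' + 1), (3 * y' + 1), (3 * z1), (3 * z').
    split=> //; last by exists x'.
    rewrite E1 /sumsq4 ht; set u := (3 * z1) ^+ 2.
    by rewrite -!(addrAC _ _ u) E'.
  have [hz|/not_avoids_sqr hz] := pselect (avoids (9 * q%:Z) (3 * z)).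
    exact: key hz E.
  have [x' [y' [z' [E' hx' hy' hz']]]] :=
    avoid_two_units_one_multiple x y q_neq0.
  by apply: (key x' y' z' t hz'); rewrite E /sumsq4 hz E'.
- move=> x y z t _ _ _ _ E.
  (* One coordinate equal to +-9q suffices: all three multiples of 3 are replaced at once, whatever
     the other two are. *)
  have key (x1 y1 z1 : int) : ~ avoids (9 * q%:Z) (3 * z1) ->
      n%:Z = sumsq4 (3 * x + 1) (3 * x1) (3 * y1) (3 * z1) ->
      primitive_avoiding (9 * q%:Z) n%:Z.
    move=> /not_avoids_sqr hz E1.
    have q3_gt0 : (0 < 3 * q)%N by lia.
    have [a' [b' [c' []]]] := avoid_three_multiples x1 y1 q3_gt0.
    have -> : 3 * (3 * q)%N%:Z = 9 * q%:Z by lia.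
    move=> E' ha hb hc; exists (3 * x + 1), a', b', c'.
    split=> //; last by exists x.
    by rewrite E1 /sumsq4 hz -!addrA; congr (_ + _); rewrite !addrA.
  have [hy|hy] := pselect (avoids (9 * q%:Z) (3 * y)); last first.
    by apply: (key z t y hy); rewrite E /sumsq4; ring.
  have [hz|hz] := pselect (avoids (9 * q%:Z) (3 * z)); last first.
    by apply: (key y t z hz); rewrite E /sumsq4; ring.
  have [ht|ht] := pselect (avoids (9 * q%:Z) (3 * t)); last exact: key ht E.
  by exists (3 * x + 1), (3 * y), (3 * z), (3 * t); split=> //; exists x.
- move=> x y z t xE yE zE tE; suff : (3 %| n)%N by rewrite (negPf n3).
  have : n%:Z = 3 * (3 * (x ^+ 2 + y ^+ 2 + z ^+ 2 + t ^+ 2)).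
    by rewrite nE xE yE zE tE /sumsq4; ring.
  lia.
Qed.

(** * Multiplication by 3 *)

(** Up to signs, these are the coordinates of (1 - i - j)(a + bi + cj + dk). *)
Lemma sumsq4_mul3 (a b c d : int) : 3 * sumsq4 a b c d
  = sumsq4 (a + b + c) (a - b + d) (a - c - d) (b - c + d).
Proof. by rewrite /sumsq4; ring. Qed.

(** Every new representation has exactly one multiple of 3, so only that coordinate must be kept
    away from +-9q. The order and signs of the old coordinates determine it, and it cannot be +-9q
    for all choices, except in one family treated by [bad]. *)
Lemma primitive_avoiding_mul3 (q n : int) : q <> 0 ->
  primitive_avoiding (9 * q) n -> primitive_avoiding (9 * q) (3 * n).
Proof.
move=> q_neq0 [a [b [c [d [-> [ha hb hc hd] [u aE]]]]]].
have na (v : int) : avoids (9 * q) (3 * v + 1) by split; lia.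
apply: (@sumsq4_mod3_wlog (avoids (9 * q)) a b c d) => //; first exact: avoidsN.
- have key (x y z t : int) : avoids (9 * q) (3 * (x + y + z + 1)) ->
      primitive_avoiding (9 * q)
        (3 * sumsq4 (3 * x + 1) (3 * y + 1) (3 * z + 1) (3 * t + 1)).
    move=> h; rewrite sumsq4_mul3.
    exists (3 * (x - y + t) + 1), (3 * (x + y + z + 1)), (3 * (z + t - x) + 1).
    exists (3 * (y - z + t) + 1); split=> //; last by exists (x - y + t).
    by rewrite /sumsq4; ring.
  move=> x y z t _ _ _ _ ->.
  have [/key//|h1] := pselect (avoids (9 * q) (3 * (x + y + z + 1))).
  have [h2|h2] := pselect (avoids (9 * q) (3 * (x + y + t + 1))).
    by move: (key x y t z h2); congr (primitive_avoiding _ (_ * _));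
       rewrite /sumsq4; ring.
  have [h3|h3] := pselect (avoids (9 * q) (3 * (x + z + t + 1))).
    by move: (key x z t y h3); congr (primitive_avoiding _ (_ * _));
       rewrite /sumsq4; ring.
  have [h4|h4] := pselect (avoids (9 * q) (3 * (y + z + t + 1))).
    by move: (key y z t x h4); congr (primitive_avoiding _ (_ * _));
       rewrite /sumsq4; ring.
  (* Four failures would add up to 3(x + y + z + t) + 4, a sum of four terms +-3q, although it is
     not a multiple of 3. *)
  by exfalso; move: h1 h2 h3 h4; clear; rewrite /avoids; lia.
- have key (x y z t : int) : avoids (9 * q) (3 * (x - y + t)) ->
      primitive_avoiding (9 * q)
        (3 * sumsq4 (3 * x + 1) (3 * y + 1) (3 * z + 1) (3 * t)).
    move=> h; exists (3 * (x + y - z) + 1), (3 * (x - y + t)).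
    exists (3 * (t - x - z - 1) + 1), (3 * (- y - z - t - 1) + 1).
    split=> //; last by exists (x + y - z).
    by rewrite /sumsq4; ring.
  move=> x y z t _ _ _ ht ->.
  have [/key//|h1] := pselect (avoids (9 * q) (3 * (x - y + t))).
  have [h2|h2] := pselect (avoids (9 * q) (3 * (y - x + t))).
    by move: (key y x z t h2); congr (primitive_avoiding _ (_ * _));
       rewrite /sumsq4; ring.
  have [h3|h3] := pselect (avoids (9 * q) (3 * (x - z + t))).
    by move: (key x z y t h3); congr (primitive_avoiding _ (_ * _));
       rewrite /sumsq4; ring.
  have [h4|h4] := pselect (avoids (9 * q) (3 * (z - x + t))).
    by move: (key z x y t h4); congr (primitive_avoiding _ (_ * _));
       rewrite /sumsq4; ring.
  have [h5|h5] := pselect (avoids (9 * q) (3 * (y - z + t))).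
    by move: (key y z x t h5); congr (primitive_avoiding _ (_ * _));
       rewrite /sumsq4; ring.
  (* As t is not +-3q, [h1] and [h2] force t = 0. All differences of x, y, z are then +-3q, but one
     of them is the sum of the two others up to sign. *)
  by exfalso; move: q_neq0 ht h1 h2 h3 h4 h5; clear; rewrite /avoids; lia.
- have key (x y z t : int) : avoids (9 * q) (3 * (x - y + z)) ->
      primitive_avoiding (9 * q)
        (3 * sumsq4 (3 * x + 1) (3 * y + 1) (3 * z) (3 * t)).
    move=> h; exists (3 * (- x - y - t - 1) + 1), (3 * (x - y + z)).
    exists (3 * (x - z - t) + 1), (3 * (y + z - t) + 1).
    split=> //; last by exists (- x - y - t - 1).
    by rewrite /sumsq4; ring.
  (* Here every product with a quaternion of norm 3 contains +-9q; this is
     the reflection of (9q', 9q' + b, - b), with b = 3y + 1. *)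
  have bad (y q' : int) : q' ^+ 2 = q ^+ 2 -> primitive_avoiding (9 * q)
      (3 * sumsq4 (3 * (y + 3 * q') + 1) (3 * y + 1) 0 0).
    move=> q'E; have q'q : q' = q \/ q' = - q.
      by move/eqP: q'E; rewrite eqf_sqr => /orP[]/eqP; [left|right].
    exists (3 * (4 * q' + y) + 1), (3 * q'), (3 * (y - q') + 1).
    exists (3 * (3 * q' + 2 * y) + 2); split.
    - by rewrite /sumsq4; ring.
    - by split=> //; rewrite /avoids; clear -q'q q_neq0; lia.
    - by exists (4 * q' + y).
  move=> x y z t _ _ hz ht ->.
  have [/key//|h1] := pselect (avoids (9 * q) (3 * (x - y + z))).
  have [h2|h2] := pselect (avoids (9 * q) (3 * (y - x + z))).
    by move: (key y x z t h2); congr (primitive_avoiding _ (_ * _));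
       rewrite /sumsq4; ring.
  have [h3|h3] := pselect (avoids (9 * q) (3 * (x - y + t))).
    by move: (key x y t z h3); congr (primitive_avoiding _ (_ * _));
       rewrite /sumsq4; ring.
  have [h4|h4] := pselect (avoids (9 * q) (3 * (y - x + t))).
    by move: (key y x t z h4); congr (primitive_avoiding _ (_ * _));
       rewrite /sumsq4; ring.
  (* Adding [h1] and [h2] puts 2z in {0, 6q, -6q}, and z is not +-3q, so z = 0. Likewise [h3] and
     [h4] give t = 0. *)
  have [z0 [t0 xy]] : z = 0 /\ t = 0 /\ (x = y + 3 * q \/ x = y + 3 * - q).
    by move: q_neq0 hz ht h1 h2 h3 h4; clear; rewrite /avoids; lia.
  rewrite z0 t0 !mulr0; case: xy => ->; apply: bad => //.
  by rewrite sqrrN.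
- move=> x y z t _ hy hz ht ->.
  have key (y1 z1 t1 : int) : avoids (9 * q) (3 * (y1 - z1 + t1)) ->
      primitive_avoiding (9 * q)
        (3 * sumsq4 (3 * x + 1) (3 * y1) (3 * z1) (3 * t1)).
    move=> h; exists (3 * (x + y1 + z1) + 1), (3 * (x - y1 + t1) + 1).
    exists (3 * (x - z1 - t1) + 1), (3 * (y1 - z1 + t1)).
    split=> //; last by exists (x + y1 + z1).
    by rewrite /sumsq4; ring.
  have [/key//|h1] := pselect (avoids (9 * q) (3 * (y - z + t))).
  have [h2|h2] := pselect (avoids (9 * q) (3 * (- y - z + t))).
    by move: (key _ _ _ h2); congr (primitive_avoiding _ (_ * _));
       rewrite /sumsq4; ring.
  have [h3|h3] := pselect (avoids (9 * q) (3 * (y - - z + t))).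
    by move: (key _ _ _ h3); congr (primitive_avoiding _ (_ * _));
       rewrite /sumsq4; ring.
  have [h4|h4] := pselect (avoids (9 * q) (3 * (y - z + - t))).
    by move: (key _ _ _ h4); congr (primitive_avoiding _ (_ * _));
       rewrite /sumsq4; ring.
  (* Flipping one sign changes the value by 2y, 2z or 2t up to sign. None of y, z, t is +-3q, so all
     vanish and 0 = +-3q. *)
  by exfalso; move: q_neq0 hy hz ht h1 h2 h3 h4; clear; rewrite /avoids; lia.
- by move=> x y z t aE' _ _ _; lia.
Qed.

Lemma primitive_avoiding_pos (q n : nat) : (0 < q)%N -> (0 < n)%N ->
  primitive_avoiding (9 * q%:Z) n%:Z.
Proof.
move=> q_gt0; elim/ltn_ind: n => n IH n_gt0.
have [/dvdnP[m nE]|] := boolP (3 %| n)%N; last exact: primitive_avoiding_coprime3.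
have -> : n%:Z = 3 * m%:Z by lia.
by apply: primitive_avoiding_mul3; [lia | apply: IH; lia].
Qed.

(* Back to natural numbers: four squares suffice, and 7 needs four *)
Local Close Scope ring_scope.

Lemma sum_of_squares_in_4 (rho n : nat) :
  0 < rho -> 9 %| rho -> 0 < n -> sum_of_squares_in (S_ rho) 4 n.
Proof.
move=> rho_gt0 /dvdnP[q rhoE] n_gt0; have q_gt0 : 0 < q by lia.
have [a [b [c [d [nE [ha hb hc hd] _]]]]] := primitive_avoiding_pos q_gt0 n_gt0.
exists (fun i => nth 0 [:: `|a|; `|b|; `|c|; `|d|]%N i); split.
  have S_absz (u : int) : avoids (9 * q%:Z) u -> `|u|%N <> rho.
    by rewrite /avoids rhoE; clear; lia.
  by case=> -[|[|[|[|//]]]] ? /=; apply: S_absz.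
have sq_absz (u : int) : Posz (`|u|%N ^ 2) = (u ^+ 2)%R.
  by rewrite -abszX gez0_abs // sqr_ge0.
rewrite !big_ord_recl big_ord0 /=; apply: (@can_inj _ _ Posz absz) => //.
by rewrite nE !PoszD !sq_absz addr0 !addrA.
Qed.

(** A square not exceeding 7 is 0, 1 or 4, and no three of these add up to 7. *)
Lemma seven_not_sum_of_squares (A : set nat) (m : nat) :
  m < 4 -> ~ sum_of_squares_in A m 7.
Proof.
move=> m_lt4 [x [_ xE]].
have x_le (i : 'I_m) : x i ^ 2 \in [:: 0; 1; 4].
  have : x i <= 2.
    by rewrite -ltnS -ltn_sqr (@leq_ltn_trans 7) // xE (bigD1 i) //= leq_addr.
  by case: (x i) => [|[|[|]]].
case: m m_lt4 x xE x_le => [|[|[|[|//]]]] _ x; rewrite ?big_ord0 //.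
- rewrite !big_ord_recl big_ord0 => xE x_le.
  by have := x_le ord0; rewrite !inE; lia.
- rewrite !big_ord_recl big_ord0 => xE x_le.
  have := x_le ord0; have := x_le (lift ord0 ord0); rewrite !inE; lia.
- rewrite !big_ord_recl big_ord0 => xE x_le.
  have := x_le ord0; have := x_le (lift ord0 ord0).
  by have := x_le (lift ord0 (lift ord0 ord0)); rewrite !inE; lia.
Qed.

Theorem theorem3p6 (rho : nat) (rho_gt0 : 0 < rho) (dvd9 : 9 %| rho) :
  M_ rho = Some 4.
Proof.
have k7 : k_ rho 7 = Some 4.
  apply/least_Some; split; first by split=> //; apply: sum_of_squares_in_4.
  move=> m [_ m7]; rewrite leqNgt; apply/negP => m_lt4.
  exact: seven_not_sum_of_squares m7.
apply/greatest_Some; split; first by exists 7; split=> // -[_]; rewrite k7.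
move=> m [n [n_gt0 _ /least_Some[_ m_least]]].
by apply: m_least; split=> //; apply: sum_of_squares_in_4.
Qed.
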